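(* Let $G$ be a strongly connected digraph with $N>2$ nodes, and let all nodes run the Privacy-Preserving Push-Sum Algorithm described in the context. Then for every node $i$, with probability one, $$\lim_{k\to\infty}\hat x^{ave}_i(k)=\lim_{k\to\infty}\frac{x^\alpha_{i,1}(k)}{x^\alpha_{i,2}(k)}=\frac1N\sum_{j=1}^N x_j(0),\qquad \lim_{k\to\infty}\frac{x^\beta_{i,1}(k)}{x^\beta_{i,2}(k)}=\frac1N\sum_{j=1}^N x_j(0).$$
   Context: Digraph conventions: $\mathcal V=\{1,\dots,N\}$, no self-loops; $(j,i)\in\mathcal E$ means node $i$ can send messages to node $j$. $N_i^{in}=\{j:(i,j)\in\mathcal E\}$, $N_i^{out}=\{j:(j,i)\in\mathcal E\}$. Strongly connected: a directed path exists from any node to any other node. Privacy-Preserving Push-Sum Algorithm (each node $i$ has a private real initial state $x_i(0)$; $M>0$ is a fixed constant). Initialization: node $i$ draws $x^\alpha_{i,1}(0)\sim U(-M,M)$ and sets $x^\beta_{i,1}(0)=2x_i(0)-x^\alpha_{i,1}(0)$, $x^\alpha_{i,2}(0)=0$, $x^\beta_{i,2}(0)=2$. Weights: at $k=0$, node $i$ draws the numbers $\{p_{ji}(0):j\in N_i^{out}\cup\{i\}\}$ and $\alpha_i(0)$ independently from $\mathcal N(0,M)$ and normalizes them so that $\sum_{j=1}^N p_{ji}(0)+\alpha_i(0)=1$; at each $k\ge1$, node $i$ draws $\{p_{ji}(k):j\in N_i^{out}\cup\{i\}\}$ and $\alpha_i(k)$ independently from $U(0,1)$ and normalizes them so that $\sum_{j=1}^N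 p_{ji}(k)+\alpha_i(k)=1$; in all cases $p_{ji}(k)=0$ if $j\notin N_i^{out}\cup\{i\}$. State update, for $k\ge0$, $l=1,2$: node $i$ sends $p_{ji}(k)x^\alpha_{i,l}(k)$ to each $j\in N_i^{out}$ and updates $$x^\alpha_{i,l}(k+1)=\sum_{j\in N_i^{in}\cup\{i\}}p_{ij}(k)x^\alpha_{j,l}(k)+x^\beta_{i,l}(k),\qquad x^\beta_{i,l}(k+1)=\alpha_i(k)x^\alpha_{i,l}(k).$$ Node $i$'s estimated average is $\hat x^{ave}_i(k+1)=x^\alpha_{i,1}(k+1)/x^\alpha_{i,2}(k+1)$. The substate $x^\beta_{i,l}$ is never transmitted. *)

(* Defs.v *)
From HB Require Import structures.
From mathcomp Require Import all_boot all_order all_algebra.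
From mathcomp Require Import all_classical all_reals all_analysis.
Set Implicit Arguments. Unset Strict Implicit. Unset Printing Implicit Defensive.
Import Order.TTheory GRing.Theory Num.Theory.
Import numFieldNormedType.Exports.
Local Open Scope classical_set_scope.
Local Open Scope ring_scope.

(* [E j i] encodes (j,i) \in \mathcal E : node i can send to node j.   *)
(* N_i^out = [pred j | E j i],  N_i^in = [pred j | E i j].             *)

Definition no_self_loops (N : nat) (E : rel 'I_N) : Prop := forall i, ~~ E i i.

Definition strongly_connected (N : nat) (E : rel 'I_N) : Prop :=
  forall u v : 'I_N, connect (fun a b => E b a) u v.

Definition out_or_self (N : nat) (E : rel 'I_N) (i j : 'I_N) : bool :=
  E j i || (j == i).

(* Random draws.  Index type of all the scalar random draws:            *)
(*   inl (inl i)        : x^alpha_{i,1}(0)                              *)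
(*   inl (inr (k,j,i))  : raw (un-normalized) draw for p_{ji}(k)        *)
(*   inr (k,i)          : raw (un-normalized) draw for alpha_i(k)       *)
Definition draw_idx (N : nat) : Type :=
  (('I_N + (nat * 'I_N * 'I_N)) + (nat * 'I_N))%type.

Definition draw_family (N : nat) (T R : Type)
  (a : 'I_N -> T -> R) (w : nat -> 'I_N -> 'I_N -> T -> R)
  (wa : nat -> 'I_N -> T -> R) (t : draw_idx N) : T -> R :=
  match t with
  | inl (inl i) => a i
  | inl (inr (k, j, i)) => w k j i
  | inr (k, i) => wa k i
  end.

Definition drawn (N : nat) (E : rel 'I_N) : set (draw_idx N) :=
  fun t => match t with
           | inl (inr (_, j, i)) => out_or_self E i j
           | _ => True
           end.

Definition mutually_independent (d : measure_display) (T : measurableType d)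
  (R : realType) (P : probability T R) (I : eqType) (X : I -> T -> R)
  (S : set I) : Prop :=
  forall (F : seq I) (B : I -> set R),
    uniq F -> (forall t, t \in F -> S t) -> (forall t, measurable (B t)) ->
    P (\big[setI/setT]_(t <- F) (X t @^-1` B t)) =
    (\prod_(t <- F) P (X t @^-1` B t))%E.

Definition has_law (d : measure_display) (T : measurableType d)
  (R : realType) (P : probability T R) (X : T -> R)
  (mu : set R -> \bar R) : Prop :=
  measurable_fun setT X /\ forall B : set R, measurable B -> P (X @^-1` B) = mu B.

(* Normalized weights: the draws {p_ji(k) : j in N_i^out \cup {i}} and  *)
(* alpha_i(k) are divided by their sum, so that                         *)
(* sum_j p_ji(k) + alpha_i(k) = 1 (p_ji(k) = 0 off N_i^out \cup {i}).   *)
Section Weights.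
Variables (R : realType) (N : nat) (E : rel 'I_N).
Variables (w : nat -> 'I_N -> 'I_N -> R) (wa : nat -> 'I_N -> R).

Definition weight_total (k : nat) (i : 'I_N) : R :=
  \sum_(j | out_or_self E i j) w k j i + wa k i.

Definition pw (k : nat) (j i : 'I_N) : R :=
  if out_or_self E i j then w k j i / weight_total k i else 0.

Definition alphaw (k : nat) (i : 'I_N) : R := wa k i / weight_total k i.
End Weights.

Fixpoint pps_state (R : realType) (N : nat) (E : rel 'I_N)
  (p : nat -> 'I_N -> 'I_N -> R) (alpha : nat -> 'I_N -> R)
  (xa0 xb0 : 'I_N -> R) (k : nat) : ('I_N -> R) * ('I_N -> R) :=
  match k with
  | 0 => (xa0, xb0)
  | k'.+1 =>
    let s := pps_state E p alpha xa0 xb0 k' in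
    (fun i => \sum_(j | (E i j) || (j == i)) p k' i j * s.1 j + s.2 i,
     fun i => alpha k' i * s.1 i)
  end.

(* The Privacy-Preserving Push-Sum run, for a given outcome of the draws.
   [l] = true : channel l = 1,  [l] = false : channel l = 2. *)
Definition pps_run (R : realType) (N : nat) (E : rel 'I_N) (x0 : 'I_N -> R)
  (a : 'I_N -> R) (w : nat -> 'I_N -> 'I_N -> R) (wa : nat -> 'I_N -> R)
  (l : bool) (k : nat) : ('I_N -> R) * ('I_N -> R) :=
  if l then
    pps_state E (pw E w wa) (alphaw E w wa) a (fun i => 2 * x0 i - a i) k
  else
    pps_state E (pw E w wa) (alphaw E w wa) (fun _ => 0) (fun _ => 2) k.

(* Main.v *)
(* On a step k >= 1 the pair (alpha substates, beta substates) is multiplied by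
   a nonnegative column-stochastic matrix, and step 0 is column-stochastic too
   as soon as the Gaussian normalizers do not vanish; so the masses 2 sum x_j(0)
   and 2N of the two channels are conserved.  If b z2 <= z1 <= b' z2 entrywise,
   then z1 - b z2 and b' z2 - z1 are nonnegative trajectories with total mass
   (b' - b) 2N; over N + 2 consecutive steps with weights bounded below by some
   c > 0, each of them spreads a fixed fraction of its mass over every entry, so
   one end of the bracket [b, b'] moves inwards by a fixed proportion.  All the
   ratios and the ratio of masses stay in the bracket.  Almost surely infinitely
   many disjoint blocks of N + 2 steps have all their raw draws in [1/2, 1] (the
   blocks are independent and equally likely), which makes the bracket shrink to
   a point.  A Gaussian normalizer is almost surely nonzero because one of its
   summands has a bounded density and is independent of the others. *)
Require Import Defs.
From HB Require Import structures.
From mathcomp Require Import all_boot all_order all_algebra.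
From mathcomp Require Import all_classical all_reals all_analysis.
From mathcomp Require Import ring lra zify measurable_realfun.
Set Implicit Arguments. Unset Strict Implicit. Unset Printing Implicit Defensive.
Import Order.TTheory GRing.Theory Num.Theory.
Import numFieldNormedType.Exports.
Local Open Scope classical_set_scope.
Local Open Scope ring_scope.

(** * Walks of prescribed length in a strongly connected digraph *)

Lemma connect_path_size (n : nat) (E : rel 'I_n) (i j : 'I_n) :
  strongly_connected E ->
  exists q, [/\ path (out_or_self E) j q, size q = n & last j q = i].
Proof.
move=> /(_ j i) /connectP [q qp ->].
have [q' q'p uq _] := shortenP qp.
have szq' : (size q' <= n)%N.
  rewrite -[X in (_ <= X)%N]card_ord ltnW //.
  by rewrite -[X in (X <= _)%N]/(size (j :: q')) -(card_uniqP uq) max_card.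
have nj m : path (out_or_self E) j (nseq m j) /\ last j (nseq m j) = j.
  by elim: m => [//|m [IH1 IH2]] /=; rewrite IH1 IH2 /out_or_self eqxx orbT.
(* A path without repeated nodes has at most [n] arcs; loops at [j], which [out_or_self] allows, pad
   it to exactly [n]. *)
exists (nseq (n - size q') j ++ q'); split.
- rewrite cat_path (nj _).1 (nj _).2 /=; apply: sub_path q'p => a b /= Eba.
  by rewrite /out_or_self Eba.
- by rewrite size_cat size_nseq subnK.
- by rewrite last_cat (nj _).2.
Qed.

(** * Linearity, mass conservation, positivity and mixing of the recursion *)

Section Dynamics.
Context (R : realType) (N : nat) (E : rel 'I_N).
Variables (p : nat -> 'I_N -> 'I_N -> R) (alpha : nat -> 'I_N -> R).
Implicit Types (s t : ('I_N -> R) * ('I_N -> R)).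
Implicit Types (u z : nat -> ('I_N -> R) * ('I_N -> R)).

Definition pps_step (k : nat) s : ('I_N -> R) * ('I_N -> R) :=
  (fun i => \sum_(j | (E i j) || (j == i)) p k i j * s.1 j + s.2 i,
   fun i => alpha k i * s.1 i).

(** Trajectories stay abstract because the recursion is linear: the argument runs on combinations of
    the two channels, which need not be runs of the algorithm. *)
Definition is_flow u := forall k, u k.+1 = pps_step k (u k).

Definition lincomb (b c : R) s t : ('I_N -> R) * ('I_N -> R) :=
  (fun i => b * s.1 i + c * t.1 i, fun i => b * s.2 i + c * t.2 i).

Definition mass s : R := \sum_i (s.1 i + s.2 i).

Definition nneg s := forall i, 0 <= s.1 i /\ 0 <= s.2 i.

Definition stochastic (k : nat) :=
  forall i, \sum_(j | out_or_self E i j) p k j i + alpha k i = 1.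

Definition weights_ge (c : R) (k : nat) :=
  (forall i j, out_or_self E i j -> c <= p k j i) /\
  (forall i, c <= alpha k i).

Lemma is_flow_lincomb b c u z :
  is_flow u -> is_flow z -> is_flow (fun k => lincomb b c (u k) (z k)).
Proof.
move=> uF zF k; rewrite uF zF /lincomb /pps_step /=; congr pair; apply/funext => i.
  rewrite !mulrDr !mulr_sumr addrACA -big_split /=.
  by congr (_ + _); apply: eq_bigr => j _; ring.
by ring.
Qed.

Lemma mass_lincomb b c s t : mass (lincomb b c s t) = b * mass s + c * mass t.
Proof.
by rewrite /mass !mulr_sumr -big_split /=; apply: eq_bigr => i _; ring.
Qed.

(** Exchanging the double sum gives the alpha substate of [j] a total factor of the weights leaving
    [j] plus [alpha k j], which is 1; beta substates only change place. Signs of the weights do not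
    matter, so the Gaussian step is covered. *)
Lemma mass_step k s : stochastic k -> mass (pps_step k s) = mass s.
Proof.
move=> st; rewrite /mass /= (eq_bigr (fun i =>
  \sum_(j | (E i j) || (j == i)) p k i j * s.1 j + (s.2 i + alpha k i * s.1 i)));
  last by move=> i _; rewrite addrA.
rewrite big_split /= (exchange_big_dep predT) //= -big_split /=.
apply: eq_bigr => j _; rewrite -mulr_suml.
rewrite (eq_bigl (fun i => out_or_self E j i)); last first.
  by move=> i; rewrite /out_or_self eq_sym.
rewrite addrCA -mulrDl st; ring.
Qed.

Lemma flow_mass (k0 : nat) u : is_flow u ->
  (forall k, (k0 <= k)%N -> stochastic k) ->
  forall k, (k0 <= k)%N -> mass (u k) = mass (u k0).
Proof.
move=> uF st k /subnK <-; elim: (k - k0)%N => // n <-.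
by rewrite addSn uF mass_step //; apply: st; rewrite leq_addl.
Qed.

Lemma nneg_le_mass s i : nneg s -> s.1 i <= mass s /\ s.2 i <= mass s.
Proof.
move=> s0; rewrite /mass (bigD1 i) //=.
have : 0 <= \sum_(j | j != i) (s.1 j + s.2 j).
  by apply: sumr_ge0 => j _; rewrite addr_ge0 //; case: (s0 j).
by case: (s0 i) => ? ?; lra.
Qed.

Lemma nneg_mass s : nneg s -> 0 <= mass s.
Proof.
by move=> s0; apply: sumr_ge0 => j _; rewrite addr_ge0 //; case: (s0 j).
Qed.

(** The other incoming terms are nonnegative, so the sum may be cut down to the single arc from [j]
    to [i]. *)
Lemma step_arc (c : R) k s i j : 0 <= c -> weights_ge c k -> nneg s ->
  out_or_self E j i ->
  c * s.1 j + s.2 i <= (pps_step k s).1 i.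
Proof.
move=> c0 [wp _] s0 Eji; rewrite /= lerD2r (bigD1 j) /=; last first.
  by rewrite eq_sym.
rewrite -[X in X <= _]addr0 lerD //.
  by rewrite ler_wpM2r //; [case: (s0 j)|exact: wp].
apply: sumr_ge0 => l /andP[Eil _]; rewrite mulr_ge0 //; last by case: (s0 l).
by rewrite (le_trans c0) //; apply: wp; rewrite /out_or_self eq_sym.
Qed.

Lemma step_nneg k s : weights_ge 0 k -> nneg s -> nneg (pps_step k s).
Proof.
move=> w0 s0 i; split.
  have := @step_arc 0 k s i i (lexx _) w0 s0.
  rewrite /out_or_self eqxx orbT mul0r add0r => /(_ isT); apply: le_trans.
  by case: (s0 i).
by rewrite mulr_ge0 //; [case: w0|case: (s0 i)].
Qed.

Lemma weights_geW (b c : R) k : b <= c -> weights_ge c k -> weights_ge b k.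
Proof.
move=> bc [h1 h2]; split=> [i j /h1|i]; first exact: le_trans.
exact: le_trans (h2 i).
Qed.

Lemma flow_nneg (k0 : nat) u : is_flow u ->
  (forall k, (k0 <= k)%N -> weights_ge 0 k) ->
  nneg (u k0) -> forall k, (k0 <= k)%N -> nneg (u k).
Proof.
move=> uF w0 u0 k /subnK <-; elim: (k - k0)%N => // n IH.
by rewrite addSn uF; apply: step_nneg => //; apply: w0; rewrite leq_addl.
Qed.

(** Each arc of the walk costs one factor [c], by [step_arc] with its beta term dropped. *)
Lemma flow_path (c : R) u (q : seq 'I_N) k j : 0 <= c -> is_flow u -> nneg (u k) ->
  (forall l, (k <= l < k + size q)%N -> weights_ge c l) ->
  path (out_or_self E) j q ->
  c ^+ size q * (u k).1 j <= (u (k + size q)%N).1 (last j q).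
Proof.
move=> c0 uF; elim: q k j => [|b q IH] k j uk wc /=.
  by rewrite addn0 mul1r.
move=> /andP[Ejb qp]; rewrite addnS -addSn exprSr -mulrA.
have wk : weights_ge c k by apply: wc => /=; lia.
apply: le_trans (IH k.+1 b _ _ qp); last 2 first.
- by rewrite uF; apply: step_nneg => //; apply: weights_geW wk.
- by move=> l lk; apply: wc => /=; lia.
rewrite ler_wpM2l ?exprn_ge0 // uF.
have := @step_arc c k (u k) b j c0 wk uk Ejb; apply: le_trans.
by rewrite lerDl; case: (uk b).
Qed.

(* Every node is reached from every other one in exactly N steps (padding with
   self-loops); a step before them empties the beta substates into the alpha
   ones and a step after them fills the beta substates again. *)
Lemma flow_mixing (c : R) u k i : strongly_connected E ->
  0 <= c <= 1 -> is_flow u -> nneg (u k) ->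
  (forall l, (k <= l < k + N.+2)%N -> weights_ge c l) ->
  c ^+ N.+2 / N%:R * mass (u k) <= (u (k + N.+2)%N).1 i /\
  c ^+ N.+2 / N%:R * mass (u k) <= (u (k + N.+2)%N).2 i.
Proof.
move=> Esc /andP[c0 c1] uF uk wc.
have N0 : 0 < N%:R :> R by rewrite ltr0n; case: (N) i => // -[].
have nn n : (n <= N.+2)%N -> nneg (u (k + n)%N).
  elim: n => [|n IH] nN; first by rewrite addn0.
  rewrite addnS uF; apply: step_nneg; last by apply: IH; lia.
  by apply: weights_geW c0 _; apply: wc; lia.
have selfarc a : out_or_self E a a by rewrite /out_or_self eqxx orbT.
have wk : weights_ge c k by apply: wc; lia.
(* Each source [j] alone forces the entry at [i] to be at least [c ^+ N.+1] times the two substates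
   of [j]; averaging these [N] bounds gives the factor 1/N. *)
have key : c ^+ N.+1 / N%:R * mass (u k) <= (u (k + N.+1)%N).1 i.
  rewrite mulrAC ler_pdivrMr // mulrC [leRHS]mulrC mulr_natl -[X in _ *+ X]card_ord.
  rewrite -sumr_const /mass mulr_suml ler_sum // => j _.
  have [q [qp szq <-]] := connect_path_size i j Esc.
  rewrite -addSnnS -[X in (k.+1 + X)%N]szq.
  apply: le_trans (@flow_path c u q k.+1 j c0 uF _ _ qp); last 2 first.
  - by rewrite -addn1; apply: nn.
  - by move=> l; rewrite szq => ?; apply: wc; lia.
  (* The extra factor [c] pays for the first step, from [j] to itself: c (s1 + s2) <= c s1 + s2
     because c <= 1. *)
  rewrite szq exprSr mulrC -mulrA ler_wpM2l ?exprn_ge0 // uF.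
  apply: le_trans (@step_arc c k (u k) j j c0 wk uk (selfarc j)).
  rewrite mulrDr lerD2l ler_piMl //; by case: (uk j).
have wk' : weights_ge c (k + N.+1) by apply: wc; lia.
have unn := nn N.+1 (leqnSn _).
rewrite exprS -2!mulrA [X in c * X]mulrA addnS uF; split.
  apply: le_trans (step_arc c0 wk' unn (selfarc i)).
  rewrite -[leLHS]addr0 lerD ?ler_wpM2l //; by case: (unn i).
apply: ler_pM => //; last by case: wk'.
by rewrite mulr_ge0 ?nneg_mass // divr_ge0 ?exprn_ge0 // ltW.
Qed.

(** The division-free form of b t <= s <= c t, for both substates: nonnegativity of two linear
    combinations, which later steps preserve. *)
Definition sandwich (b c : R) s t :=
  nneg (lincomb 1 (- b) s t) /\ nneg (lincomb (- 1) c s t).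

Definition good_block (c : R) (k : nat) :=
  forall l, (k <= l < k + N.+2)%N -> weights_ge c l.

(** * Contraction of the bracket and convergence of the ratios *)

Section Ratio.
Variables (k0 : nat) (z1 z2 : nat -> ('I_N -> R) * ('I_N -> R)) (c : R).
Hypotheses (Esc : strongly_connected E) (c01 : 0 <= c <= 1).
Hypotheses (z1F : is_flow z1) (z2F : is_flow z2).
Hypothesis st : forall k, (k0 <= k)%N -> stochastic k.
Hypothesis w0 : forall k, (k0 <= k)%N -> weights_ge 0 k.
Hypothesis z2_gt0 :
  forall k, (k0 <= k)%N -> forall i, 0 < (z2 k).1 i /\ 0 < (z2 k).2 i.
Hypothesis blocks : forall k, exists2 k', (k <= k')%N & good_block c k'.

Let W := mass (z2 k0).

(** The fraction of its total mass that a nonnegative trajectory has in every entry after a good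
    block. *)
Let delta := c ^+ N.+2 / N%:R.

Lemma sandwich_flow b b' k k' : (k0 <= k)%N -> (k <= k')%N ->
  sandwich b b' (z1 k) (z2 k) -> sandwich b b' (z1 k') (z2 k').
Proof.
move=> k0k kk' [h1 h2]; split.
- apply: (@flow_nneg k (fun k => lincomb 1 (- b) (z1 k) (z2 k))) => //.
    exact: is_flow_lincomb.
  by move=> l kl; apply: w0; lia.
- apply: (@flow_nneg k (fun k => lincomb (- 1) b' (z1 k) (z2 k))) => //.
    exact: is_flow_lincomb.
  by move=> l kl; apply: w0; lia.
Qed.

Lemma z2_le_mass k i : (k0 <= k)%N -> (z2 k).1 i <= W /\ (z2 k).2 i <= W.
Proof.
move=> k0k; rewrite /W -(flow_mass z2F st k0k).
by apply: nneg_le_mass => j; case: (z2_gt0 k0k j) => *; split; exact: ltW.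
Qed.

(** The gaps z1 - b z2 and b' z2 - z1 have masses summing to (b' - b) W, so one has at least half of
    it. After the block each of its entries is at least delta (b' - b) W / 2, and since z2 <= W that
    end can move by delta / 2 times the width. *)
Lemma flow_contract b b' k : (k0 <= k)%N -> good_block c k ->
  sandwich b b' (z1 k) (z2 k) ->
  exists d d', sandwich d d' (z1 (k + N.+2)%N) (z2 (k + N.+2)%N) /\
    d' - d = (1 - delta / 2) * (b' - b).
Proof.
move=> k0k gk sbb'.
have [h1 h2] := sandwich_flow k0k (leq_addr N.+2 k) sbb'.
have [hk1 hk2] := sbb'.
have mW : mass (lincomb 1 (- b) (z1 k) (z2 k)) +
    mass (lincomb (- 1) b' (z1 k) (z2 k)) = (b' - b) * W.
  rewrite !mass_lincomb /W -(flow_mass z2F st k0k); ring.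
have m1 := nneg_mass hk1; have m2 := nneg_mass hk2.
have d0 : 0 <= delta by case/andP: c01 => ? ?; rewrite divr_ge0 ?exprn_ge0.
have zW := @z2_le_mass (k + N.+2) _ (leq_trans k0k (leq_addr _ _)).
(* Without nodes the bracket is vacuous and any pair of ends of the right width will do; otherwise a
   node gives [W] > 0. *)
have [N0|/existsNP [i0 _]] := pselect (forall i : 'I_N, False).
  by exists b, (b + (1 - delta / 2) * (b' - b)); split; [split=> i; case: (N0 i)|ring].
have W0 : 0 < W.
  by apply: lt_le_trans (zW i0).1; case: (z2_gt0 (leq_trans k0k (leq_addr N.+2 k)) i0).
have bb' : 0 <= b' - b by rewrite -(pmulr_lge0 _ W0) -mW addr_ge0.
have aux x : x <= W -> delta / 2 * (b' - b) * x <= delta * ((b' - b) * W / 2).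
  move=> xW; rewrite [leRHS](_ : _ = delta / 2 * (b' - b) * W); last by field.
  apply: ler_wpM2l xW; apply: mulr_ge0 => //; apply: divr_ge0 => //.
have [big1|big2] := leP ((b' - b) * W / 2) (mass (lincomb 1 (- b) (z1 k) (z2 k))).
- exists (b + delta / 2 * (b' - b)), b'; split; last by ring.
  split=> // i.
  have [/= f1 f2] := @flow_mixing c _ k i Esc c01 (is_flow_lincomb 1 (- b) z1F z2F) hk1 gk.
  have [/aux a1 /aux a2] := zW i.
  have := ler_wpM2l d0 big1; rewrite -/delta in f1 f2 => big1'.
  split=> /=; lra.
- exists b, (b' - delta / 2 * (b' - b)); split; last by ring.
  split=> // i.
  have [/= f1 f2] := @flow_mixing c _ k i Esc c01 (is_flow_lincomb (- 1) b' z1F z2F) hk2 gk.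
  have [/aux a1 /aux a2] := zW i.
  have big2' : (b' - b) * W / 2 <= mass (lincomb (- 1) b' (z1 k) (z2 k)) by lra.
  have := ler_wpM2l d0 big2'; rewrite -/delta in f1 f2 => big3.
  split=> /=; lra.
Qed.

Lemma sandwich_init : exists b b', sandwich b b' (z1 k0) (z2 k0).
Proof.
(* Summing the absolute ratios over all nodes and both substates gives one bound for each of
   them. *)
pose r i := `|(z1 k0).1 i| / (z2 k0).1 i + `|(z1 k0).2 i| / (z2 k0).2 i.
have r0 i : 0 <= r i.
  by case: (z2_gt0 (leqnn _) i) => ? ?; rewrite addr_ge0 ?divr_ge0 // ltW.
pose B := \sum_i r i.
have rB i : r i <= B by rewrite /B (bigD1 i) //= lerDl sumr_ge0.
have key i : `|(z1 k0).1 i| <= B * (z2 k0).1 i /\ `|(z1 k0).2 i| <= B * (z2 k0).2 i.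
  case: (z2_gt0 (leqnn _) i) => p1 p2; rewrite -!ler_pdivrMr //; split;
  apply: le_trans (rB i); by rewrite ?lerDl ?lerDr divr_ge0 // ltW.
exists (- B), B; split=> i /=; case: (key i); rewrite !ler_norml => /andP[? ?] /andP[? ?];
 split; lra.
Qed.

(** The bracket persists until the next good block starts, and each such block multiplies its width
    by 1 - delta / 2. *)
Lemma sandwich_iter : exists B, forall n, exists k b b',
  [/\ (k0 <= k)%N, sandwich b b' (z1 k) (z2 k) &
    b' - b = (1 - delta / 2) ^+ n * B].
Proof.
have [b [b' sbb']] := sandwich_init; exists (b' - b); elim=> [|n IH].
  by exists k0, b, b'; rewrite mul1r.
have [k [d [d' [k0k sdd' dd']]]] := IH.
have [k' kk' gk'] := blocks k.
have k0k' := leq_trans k0k kk'.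
have [e [e' [see' ee']]] := flow_contract k0k' gk' (sandwich_flow k0k kk' sdd').
exists (k' + N.+2)%N, e, e'; split=> //; first by lia.
by rewrite ee' dd' exprS mulrA.
Qed.

(** The ratio of masses lies in the bracket as well: the two gaps have nonnegative mass, and masses
    are conserved. *)
Lemma sandwich_ratio b b' k i : (k0 <= k)%N -> sandwich b b' (z1 k) (z2 k) ->
  `|mass (z1 k0) / mass (z2 k0) - (z1 k).1 i / (z2 k).1 i| <= b' - b /\
  `|mass (z1 k0) / mass (z2 k0) - (z1 k).2 i / (z2 k).2 i| <= b' - b.
Proof.
move=> k0k [h1 h2].
have := nneg_mass h1; have := nneg_mass h2; rewrite !mass_lincomb.
rewrite (flow_mass z1F st k0k) (flow_mass z2F st k0k) => m2 m1.
have [p1 p2] := z2_gt0 k0k i.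
have W0 : 0 < mass (z2 k0) := lt_le_trans p1 (z2_le_mass i k0k).1.
have bnd x y : 0 < y -> 0 <= 1 * x + - b * y -> 0 <= - 1 * x + b' * y ->
    b <= x / y <= b'.
  by move=> y0 e1 e2; rewrite ler_pdivlMr // ler_pdivrMr //; apply/andP; split; lra.
have /andP[m3 m4] := bnd _ _ W0 m1 m2.
have [/= a1 a2] := h1 i; have [/= b1 b2] := h2 i.
have /andP[q1 q2] := bnd _ _ p1 a1 b1.
have /andP[q3 q4] := bnd _ _ p2 a2 b2.
by rewrite !ler_norml; split; apply/andP; split; lra.
Qed.

Lemma flow_ratio_cvg i : 0 < c ->
  ((fun k => (z1 k).1 i / (z2 k).1 i) @ \oo --> mass (z1 k0) / mass (z2 k0)) /\
  ((fun k => (z1 k).2 i / (z2 k).2 i) @ \oo --> mass (z1 k0) / mass (z2 k0)).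
Proof.
move=> c_gt0; have [B hB] := sandwich_iter.
have N1 : 1 <= N%:R :> R by rewrite ler1n; case: (N) i => // -[].
have d0 : 0 < delta by rewrite divr_gt0 ?exprn_gt0 // (lt_le_trans _ N1).
have d1 : delta <= 1.
  case/andP: c01 => c0 c1; rewrite ler_pdivrMr ?(lt_le_trans _ N1) // mul1r.
  by rewrite (le_trans _ N1) // exprn_ile1.
have key e : 0 < e -> \forall k \near \oo,
  `|mass (z1 k0) / mass (z2 k0) - (z1 k).1 i / (z2 k).1 i| < e /\
  `|mass (z1 k0) / mass (z2 k0) - (z1 k).2 i / (z2 k).2 i| < e.
  move=> e0.
  have cvgB : (fun n => (1 - delta / 2) ^+ n * B) @ \oo --> (0 : R).
    rewrite -[X in _ --> X](mul0r B); apply: cvgMr_tmp.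
    by apply: cvg_expr; rewrite ger0_norm; lra.
  have [n _ /(_ n (leqnn n)) ne] := cvgr0_norm_lt _ cvgB _ e0.
  have [k [b [b' [k0k sbb' bb']]]] := hB n.
  (* The narrow bracket reached at time [k] confines the ratios at all later times. *)
  exists k => // k' /= kk'.
  have [r1 r2] := sandwich_ratio i (leq_trans k0k kk') (sandwich_flow k0k kk' sbb').
  have lte : b' - b < e by rewrite bb'; apply: le_lt_trans ne; exact: ler_norm.
  by split; [apply: le_lt_trans r1 lte|apply: le_lt_trans r2 lte].
by split; apply/cvgrPdist_lt => e /key; apply: filterS => k [].
Qed.

End Ratio.
End Dynamics.

(** * Independent events of equal positive probability occur infinitely often *)

Section InfinitelyOften.
Context (d : measure_display) (T : measurableType d) (R : realType)
  (P : probability T R).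

Lemma measurable_bigsetI (I : eqType) (s : seq I) (A : I -> set T) :
  (forall t, t \in s -> measurable (A t)) ->
  measurable (\big[setI/setT]_(t <- s) A t).
Proof.
move=> mA; rewrite big_seq; elim/big_ind : _ => //.
by move=> X Y; exact: measurableI.
Qed.

Variables (G : nat -> set T) (q : R).
Hypothesis mG : forall n, measurable (G n).
Hypothesis indG : forall s, uniq s ->
  P (\big[setI/setT]_(n <- s) G n) = (q ^+ size s)%:E.

(** The product rule passes to complements one event at a time, through P(D minus G) = P(D) - P(D
    and G). *)
Lemma prob_inter_compl (s s' : seq nat) : uniq (s ++ s') ->
  P (\big[setI/setT]_(n <- s) G n `&` \big[setI/setT]_(n <- s') ~` G n) =
  (q ^+ size s * (1 - q) ^+ size s')%:E.
Proof.
elim: s' s => [|n s' IH] s us.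
  by rewrite big_nil setIT indG ?mulr1 //; rewrite cats0 in us.
set A := \big[setI/setT]_(n <- s) G n.
set B := \big[setI/setT]_(n <- s') ~` G n.
have mA : measurable A by apply: measurable_bigsetI.
have mB : measurable B by apply: measurable_bigsetI => t _; exact: measurableC.
have mAB := measurableI _ _ mA mB.
rewrite big_cons (_ : A `&` _ = (A `&` B) `\` G n); last first.
  by rewrite setDE -setIA [B `&` _]setIC.
have -> : P ((A `&` B) `\` G n) = (P (A `&` B) - P (A `&` B `&` G n))%E.
  by rewrite measureD // (le_lt_trans (probability_le1 _ _)) ?ltry.
have us1 : uniq (s ++ s').
  by apply: subseq_uniq us; rewrite cat_subseq // subseq_cons.
have us2 : uniq ((n :: s) ++ s').
  by move: us; rewrite -(perm_uniq (permEl (perm_catCA s [:: n] s'))).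
rewrite IH //.
rewrite (_ : A `&` B `&` G n = \big[setI/setT]_(n <- n :: s) G n `&` B); last first.
  by rewrite big_cons setIC setIA.
rewrite IH //.
by rewrite -EFinB /= !exprS; congr EFin; ring.
Qed.

(** No occurrence from [m] on entails [r] successive failures, of probability [(1 - q) ^+ r], which
    tends to 0; there are countably many [m]. *)
Lemma prob_infinitely_often : 0 < q ->
  \forall om \ae P, forall m, exists2 n, (m <= n)%N & G n om.
Proof.
move=> q0; apply: ae_foralln => m.
pose A := \bigcap_(n in [set n | (m <= n)%N]) ~` G n.
have mA : measurable A.
  by apply: bigcap_measurable => [|n _]; [exists m => /=|exact: measurableC].
suff PA : P A = 0%E.
  by exists A; split=> // om /= h n /= mn Gn; apply: h; exists n.
have q1 : q <= 1.
  have := probability_le1 P (mG 0).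
  by have := @indG [:: 0%N] isT; rewrite big_seq1 => ->; rewrite expr1 lee_fin.
have le r : (P A <= ((1 - q) ^+ r)%:E)%E.
  have := @prob_inter_compl [::] (iota m r) (iota_uniq m r).
  rewrite big_nil setTI size_iota mul1r => <-.
  rewrite le_measure ?inE //.
    by apply: measurable_bigsetI => t _; exact: measurableC.
  rewrite big_seq => om Aom; elim/big_ind : _ => //.
  by move=> i; rewrite mem_iota => /andP[mi _]; exact: Aom.
have fA : P A \is a fin_num by rewrite fin_num_measure.
rewrite -(fineK fA); congr EFin.
apply/eqP; rewrite eq_le fine_ge0 // andbT.
have cv : (1 - q) ^+ n @[n --> \oo] --> (0 : R).
  by apply: cvg_expr; rewrite ger0_norm ?subr_ge0 // gtrBl.
apply: (cvgr_to_ge cv); apply: nearW => n.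
by rewrite -lee_fin fineK.
Qed.
End InfinitelyOften.

(** * A sum of independent variables, one with bounded density, is almost surely nonzero *)

Section SmallBall.
Context (d : measure_display) (T : measurableType d) (R : realType)
  (P : probability T R).

Lemma probability_partition (C : nat -> set T) (A : set T) :
  measurable A -> (forall n, measurable (C n)) -> trivIset setT C ->
  \bigcup_n C n = setT -> P A = (\sum_(0 <= n <oo) P (A `&` C n))%E.
Proof.
move=> mA mC tC CT.
have mAC n : measurable (A `&` C n) by exact: measurableI.
rewrite -measure_semi_bigcup //; last 2 first.
- exact: trivIset_setIl.
- exact: bigcupT_measurable.
by rewrite -setI_bigcupr CT setIT.
Qed.

(** The grid of mesh [h] is indexed by naturals, through the pickling of integers, to suit countable
    sums; a natural coding no integer gets the empty set. *)
Definition cell (h : R) (n : nat) : set R :=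
  if (pickle_inv n : option int) is Some m
  then `[m%:~R * h, (m + 1)%:~R * h[ else set0.

Lemma measurable_cell h n : measurable (cell h n).
Proof. by rewrite /cell; case: pickle_inv => // m; exact: measurable_itv. Qed.

Lemma cellE (h x : R) n : 0 < h -> cell h n x <-> n = pickle (Num.floor (x / h)).
Proof.
move=> h0; rewrite /cell; split.
  have := @pickle_invK int n; case: pickle_inv => //= m <-.
  rewrite in_itv /= -ler_pdivlMr // -ltr_pdivrMr // => mx.
  by rewrite (floor_def mx).
move=> ->; rewrite pickleK_inv /= in_itv /= -ler_pdivlMr // -ltr_pdivrMr //.
exact: floor_itv.
Qed.

Lemma cell_dist (h : R) n : 0 < h -> exists y, forall x, cell h n x -> `|x - y| <= h.
Proof.
move=> h0; rewrite /cell; case: pickle_inv => [m|]; last by exists 0.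
exists (m%:~R * h) => x; rewrite /= in_itv /= intrD mulrDl mul1r => /andP[x1 x2].
by rewrite ler_norml; apply/andP; split; lra.
Qed.

Variables (I : eqType) (X : I -> T -> R) (S : set I).
Hypothesis indX : mutually_independent P X S.
Hypothesis mX : forall t, S t -> measurable_fun setT (X t).

Lemma measurable_preX t (B : set R) : S t -> measurable B -> measurable (X t @^-1` B).
Proof. by move=> St mB; rewrite -[X in measurable X]setTI; exact: mX. Qed.

Lemma indep_cons t (F : seq I) (C : set R) (B : I -> set R) :
  uniq (t :: F) -> S t -> (forall s, s \in F -> S s) ->
  measurable C -> (forall s, measurable (B s)) ->
  P (X t @^-1` C `&` \big[setI/setT]_(s <- F) (X s @^-1` B s)) =
  (P (X t @^-1` C) * P (\big[setI/setT]_(s <- F) (X s @^-1` B s)))%E.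
Proof.
move=> /= /andP[tF uF] St SF mC mB.
(* Independence takes one family of sets, so [C] is stored at [t]; as [t] is not in [F], the other
   events are unchanged. *)
pose B' s := if s == t then C else B s.
have BB' (V : Type) (f : I -> set R -> V) (op : V -> V -> V) (v : V) :
    \big[op/v]_(s <- F) f s (B s) = \big[op/v]_(s <- F) f s (B' s).
  apply: eq_big_seq => s sF; rewrite /B'; case: eqP => // st.
  by rewrite -st sF in tF.
have mB' s : measurable (B' s) by rewrite /B'; case: ifP.
rewrite (BB' _ (fun s D => X s @^-1` D)).
have -> : C = B' t by rewrite /B' eqxx.
have := indX (F := t :: F) (B := B'); rewrite /= !big_cons tF uF => -> //; last first.
  by move=> s; rewrite inE => /orP[/eqP ->//|/SF].
by rewrite (indX uF SF mB').
Qed.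

Lemma measurable_sumX (F : seq I) : (forall s, s \in F -> S s) ->
  measurable_fun setT (fun om => \sum_(s <- F) X s om).
Proof.
elim: F => [|t F IH] SF.
  by under eq_fun do rewrite big_nil; exact: measurable_cst.
under eq_fun do rewrite big_cons.
apply: measurable_funD; first by apply/mX/SF; rewrite mem_head.
by apply: IH => s sF; apply: SF; rewrite inE sF orbT.
Qed.

Lemma measurable_dist_sumX (F : seq I) t c eps : S t -> (forall s, s \in F -> S s) ->
  measurable [set om | `|X t om + \sum_(s <- F) X s om - c| <= eps].
Proof.
move=> St SF.
have mf : measurable_fun setT (fun om => X t om + \sum_(s <- F) X s om).
  by apply: measurable_funD; [exact: mX|exact: measurable_sumX].
rewrite (_ : [set _ | _] = (fun om => X t om + \sum_(s <- F) X s om) @^-1`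
   `[c - eps, c + eps]).
  by rewrite -[X in measurable X]setTI; apply: mf => //; exact: measurable_itv.
by apply/seteqP; split=> om /=; rewrite in_itv /= ler_distl.
Qed.

(* Slicing one summand at a time into cells of width h replaces it by a
   constant up to an error h, until only the variable with bounded density is
   left; the slices enter the product rule through the events indexed by H. *)
Lemma small_ball (K h : R) t : 0 <= K -> 0 < h -> S t ->
  (forall a b, a <= b -> (P (X t @^-1` `[a, b]) <= (K * (b - a))%:E)%E) ->
  forall (F H : seq I) (B : I -> set R) (c eps : R), 0 <= eps ->
  uniq (t :: F ++ H) -> (forall s, s \in F ++ H -> S s) ->
  (forall s, measurable (B s)) ->
  (P (\big[setI/setT]_(s <- H) (X s @^-1` B s) `&`
      [set om | (`|X t om + \sum_(s <- F) X s om - c| <= eps)%R]) <=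
   (K * 2 * (eps + (size F)%:R * h))%:E *
   P (\big[setI/setT]_(s <- H) (X s @^-1` B s)))%E.
Proof.
move=> K0 h0 St hK; elim=> [|s F IH] H B c eps e0 uFH SFH mB.
  rewrite setIC (_ : [set _ | _] = X t @^-1` `[c - eps, c + eps]); last first.
    by apply/seteqP; split=> om /=; rewrite big_nil addr0 in_itv /= ler_distl.
  rewrite indep_cons //.
  apply: lee_wpmul2r => //.
  have cc : c - eps <= c + eps by lra.
  apply: le_trans (hK _ _ cc) _.
  by rewrite lee_fin /= mul0r addr0; lra.
set A := \big[setI/setT]_(s <- H) _.
set D := [set om | _].
have SH s' : s' \in H -> S s' by move=> sH; apply: SFH; rewrite mem_cat sH orbT.
have Ss : S s by apply: SFH; rewrite mem_head.
have SF s' : s' \in F -> S s' by move=> sF; apply: SFH; rewrite inE mem_cat sF orbT.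
have mA : measurable A.
  by apply: measurable_bigsetI => u uH; apply: measurable_preX => //; exact: SH.
have mD : measurable D.
  apply: (@measurable_dist_sumX (s :: F)) => // u.
  by rewrite inE => /orP[/eqP->|/SF].
pose C n := X s @^-1` cell h n.
have mC n : measurable (C n) by apply: measurable_preX => //; exact: measurable_cell.
have tC : trivIset setT C.
  by move=> m n _ _ [om [/(cellE _ _ h0) -> /(cellE _ _ h0) ->]].
have CT : \bigcup_n C n = setT.
  apply/seteqP; split=> // om _; exists (pickle (Num.floor (X s om / h))) => //.
  exact/(cellE _ _ h0).
rewrite (probability_partition _ mC tC CT); last exact: measurableI.
rewrite (probability_partition mA mC tC CT) -nneseriesZl //.
apply: lee_nneseries => // n _.
have [y hy] := cell_dist n h0.
pose B' u := if u == s then cell h n else B u.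
have AB' : A `&` C n = \big[setI/setT]_(u <- s :: H) (X u @^-1` B' u).
  rewrite big_cons setIC /B' eqxx; congr (_ `&` _).
  apply: eq_big_seq => u uH; case: eqP => // us.
  by move: uFH; rewrite /= cat_uniq mem_cat -us uH orbT !andbF.
(* On this slice [X s] is within [h] of [y]: the centre absorbs [y], the radius grows by [h], and
   the slice joins the events of [H]. *)
have := IH (s :: H) B' (c - y) (eps + h).
rewrite -AB' => IH'.
have DD' : (P (A `&` D `&` C n) <= P (A `&` C n `&`
    [set om | (`|X t om + \sum_(s0 <- F) X s0 om - (c - y)| <= eps + h)%R]))%E.
  rewrite le_measure ?inE //.
  - by apply: measurableI => //; exact: measurableI.
  - apply: measurableI; first exact: measurableI.
    exact: measurable_dist_sumX.
  move=> om [[Aom Dom] Com]; split=> //; move: Dom; rewrite /D /= big_cons => Dom.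
  have := hy _ Com; rewrite !ler_norml in Dom * => /andP[h1 h2].
  move/andP: Dom => [h3 h4]; apply/andP; split; lra.
apply: (le_trans DD'); apply: (le_trans (IH' _ _ _ _)).
- by lra.
- move: uFH; rewrite -[(s :: F) ++ H]/([:: s] ++ (F ++ H)) -[s :: H]/([:: s] ++ H).
  by rewrite !(cons_uniq t) (perm_mem (permEl (perm_catCA [:: s] F H)))
    (perm_uniq (permEl (perm_catCA [:: s] F H))).
- by move=> u; rewrite mem_cat inE => /or3P[/SF|/eqP->|/SH].
- by move=> u; rewrite /B'; case: ifP => // _; exact: measurable_cell.
apply: lee_wpmul2r => //; rewrite lee_fin /= -natr1.
by apply: ler_wpM2l; [lra|lra].
Qed.

(** The case of radius 0 and no slicing events in [small_ball]: the bound is a constant times [h],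
    with [h] arbitrarily small. *)
Lemma prob_sum_eq0 (K : R) t (F : seq I) : 0 <= K -> S t ->
  (forall a b, a <= b -> (P (X t @^-1` `[a, b]) <= (K * (b - a))%:E)%E) ->
  uniq (t :: F) -> (forall s, s \in F -> S s) ->
  \forall om \ae P, X t om + \sum_(s <- F) X s om != 0.
Proof.
move=> K0 St hK uF SF.
pose A := [set om | `|X t om + \sum_(s <- F) X s om - 0| <= 0].
have mA : measurable A by exact: measurable_dist_sumX.
suff PA : P A = 0%E.
  exists A; split=> // om /= /negP; rewrite negbK => /eqP e.
  by rewrite /A /= e subr0 normr0.
have le h : 0 < h -> (P A <= (K * 2 * ((size F)%:R * h))%:E)%E.
  move=> h0; have := @small_ball K h t K0 h0 St hK F [::] (fun _ => setT) 0 0 (lexx _).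
  rewrite cats0 big_nil setTI probability_setT mule1 add0r; exact.
have fA : P A \is a fin_num by rewrite fin_num_measure.
rewrite -(fineK fA); congr EFin.
apply/eqP; rewrite eq_le fine_ge0 // andbT.
apply/ler_addgt0Pr => e e0; rewrite add0r.
(* The added 1 keeps [b] positive, so that [h] can be chosen as [e / b]. *)
pose b := K * 2 * (size F)%:R + 1.
have b0 : 0 < b by rewrite /b ltr_wpDl // !mulr_ge0.
have /le := divr_gt0 e0 b0; rewrite -(fineK fA) lee_fin => /le_trans; apply.
rewrite (_ : K * 2 * _ = (b - 1) * e / b); last by rewrite /b; field; rewrite gt_eqF.
by rewrite ler_pdivrMr //; lra.
Qed.
End SmallBall.

(** * Interval estimates for the normal and uniform laws *)

Section Laws.
Context (R : realType).

Lemma normal_prob_itv_le (s a b : R) : s != 0 -> a <= b ->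
  (normal_prob 0 s `[a, b] <= (normal_peak s * (b - a))%:E)%E.
Proof.
move=> s0 ab; rewrite /normal_prob.
apply: (@le_trans _ _
    (\int[lebesgue_measure]_(x in `[a, b]) (normal_peak s)%:E))%E; last first.
  rewrite integral_cst //= lebesgue_measure_itv /= lte_fin.
  have [ab'|ba] := ltP a b; first by rewrite -EFinB -EFinM.
  by rewrite mule0 lee_fin mulr_ge0 ?normal_peak_ge0 ?subr_ge0.
apply: ge0_le_integral => //=.
- by move=> x _; rewrite lee_fin normal_pdf_ge0.
- apply/measurable_EFinP/measurable_funTS.
  exact: measurable_normal_pdf.
- by move=> x _; rewrite lee_fin normal_pdf_ub.
Qed.

Lemma uniform01_half : uniform_prob (@ltr01 R) `[2^-1, 1] = (2^-1)%:E.
Proof.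
rewrite /uniform_prob integral_uniform_pdf setIidl; last first.
  by move=> x; rewrite /= !in_itv /= => /andP[x1 x2]; apply/andP; split; lra.
rewrite (eq_integral (fun=> 1%:E)); last first.
  move=> x; rewrite inE /= in_itv /= /uniform_pdf => /andP[x1 x2].
  by rewrite ifT ?subr0 ?invr1 //; apply/andP; split; lra.
rewrite integral_cst //= lebesgue_measure_itv /= lte_fin ifT; last by lra.
by rewrite mul1e -EFinB; congr EFin; lra.
Qed.

Lemma uniform01_le0 : uniform_prob (@ltr01 R) `]-oo, 0] = 0%E.
Proof.
rewrite /uniform_prob integral_uniform_pdf.
rewrite (_ : `]-oo, 0] `&` `[0, 1] = [set 0]).
  by rewrite integral_set1.
apply/seteqP; split=> x /=; rewrite !in_itv /=.
  by case=> x0 /andP[x1 _]; apply/eqP; rewrite eq_le x0.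
by move=> ->; rewrite lexx ler01.
Qed.
End Laws.

(** * Disjoint blocks of independent draws *)

Lemma uniq_flatten_map (I J : eqType) (tag : I -> J) (b : J -> seq I) (s : seq J) :
  (forall j, j \in s -> uniq (b j)) ->
  (forall j t, j \in s -> t \in b j -> tag t = j) ->
  uniq s -> uniq (flatten (map b s)).
Proof.
elim: s => //= j s IH ub tb /andP[js us]; rewrite cat_uniq ub ?mem_head //=.
rewrite IH ?andbT //; last 2 first.
- by move=> k ks; apply: ub; rewrite inE ks orbT.
- by move=> k t ks; apply: tb; rewrite inE ks orbT.
apply/hasPn => t /flatten_mapP [k ks tk]; apply/negP => tj.
have ktj : k = j.
  by rewrite -(tb j t (mem_head _ _) tj) (tb k t) // inE ks orbT.
by rewrite ktj (negbTE js) in ks.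
Qed.

Section Blocks.
Context (d : measure_display) (T : measurableType d) (R : realType)
  (P : probability T R).

Lemma prod_EFin_cst (I : eqType) (F : seq I) (f : I -> \bar R) (c : R) :
  (forall t, t \in F -> f t = c%:E) ->
  (\prod_(t <- F) f t = (c ^+ size F)%:E)%E.
Proof.
elim: F => [|t F IH] fc; first by rewrite big_nil.
rewrite big_cons fc ?mem_head // IH -?EFinM ?exprS // => s sF.
by apply: fc; rewrite inE sF orbT.
Qed.

(** The [tag] makes the blocks disjoint, so their concatenation is one duplicate-free list to which
    independence applies directly. *)
Lemma prob_blocks (I : eqType) (X : I -> T -> R) (S : set I)
    (b : nat -> seq I) (tag : I -> nat) (C : set R) (c : R) (m : nat) :
  mutually_independent P X S -> measurable C ->
  (forall n, uniq (b n)) -> (forall n, size (b n) = m) ->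
  (forall n t, t \in b n ->
     [/\ S t, tag t = n & P (X t @^-1` C) = c%:E]) ->
  forall s, uniq s ->
  P (\big[setI/setT]_(n <- s) \big[setI/setT]_(t <- b n) (X t @^-1` C)) =
  ((c ^+ m) ^+ size s)%:E.
Proof.
move=> indX mC ub szb hb s us.
have -> : \big[setI/setT]_(n <- s) \big[setI/setT]_(t <- b n) (X t @^-1` C) =
    \big[setI/setT]_(t <- flatten (map b s)) (X t @^-1` C).
  by rewrite big_flatten big_map.
rewrite (indX _ (fun=> C)) //; last 2 first.
- apply: (uniq_flatten_map (tag := tag)) => // n t _ /hb []//.
- by move=> t /flatten_mapP [n _ /hb []].
rewrite (@prod_EFin_cst _ _ _ c); last by move=> t /flatten_mapP [n _ /hb []].
congr EFin; rewrite -exprM; congr (_ ^+ _).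
elim: s {us} => [|n s IH] /=; first by rewrite muln0.
by rewrite size_cat szb IH mulnS.
Qed.

Lemma ae_forall_count (I : countType) (Q : I -> T -> Prop) :
  (forall t, \forall om \ae P, Q t om) -> \forall om \ae P, forall t, Q t om.
Proof.
move=> hQ; have : \forall om \ae P, forall n : nat,
    if (pickle_inv n : option I) is Some t then Q t om else True.
  apply: ae_foralln => n; case: pickle_inv => [t|]; first exact: hQ.
  exact: aeW.
by apply: filterS => om h t; have := h (pickle t); rewrite pickleK_inv.
Qed.
End Blocks.

(** * Convergence for a fixed outcome of the draws *)

Section Run.
Context (R : realType) (N : nat) (E : rel 'I_N) (x0 a : 'I_N -> R)
  (w : nat -> 'I_N -> 'I_N -> R) (wa : nat -> 'I_N -> R).
Hypothesis Esc : strongly_connected E.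
Hypothesis total0 : forall j, weight_total E w wa 0 j != 0.
Hypothesis w_gt0 : forall k i j, (0 < k)%N -> out_or_self E i j -> 0 < w k j i.
Hypothesis wa_gt0 : forall k i, (0 < k)%N -> 0 < wa k i.

Definition large_draws (l : nat) :=
  (forall i j, out_or_self E i j -> 2^-1 <= w l j i <= 1) /\
  (forall i, 2^-1 <= wa l i <= 1).

Hypothesis large : forall k, exists2 k', (k <= k')%N &
  forall l, (k' <= l < k' + N.+2)%N -> large_draws l.

Let p := pw E w wa.
Let al := alphaw E w wa.
(** A raw draw of at least 1/2 divided by a normalizer with at most N + 1 summands, each at most
    1. *)
Let c : R := (2 * N.+1%:R)^-1.

Lemma weight_total_gt0 k i : (0 < k)%N -> 0 < weight_total E w wa k i.
Proof.
move=> k0; rewrite /weight_total ltr_wpDl ?wa_gt0 //.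
by apply: sumr_ge0 => j Eij; apply/ltW/w_gt0.
Qed.

Lemma weights_stochastic k : stochastic E p al k.
Proof.
move=> i; have t0 : weight_total E w wa k i != 0.
  by case: k => [//|k]; rewrite gt_eqF // weight_total_gt0.
rewrite (eq_bigr (fun j => w k j i / weight_total E w wa k i)).
  by rewrite -mulr_suml /al /alphaw -mulrDl divff.
by move=> j; rewrite /p /pw => ->.
Qed.

Lemma weights_gt0 k : (0 < k)%N ->
  (forall i j, out_or_self E i j -> 0 < p k j i) /\ (forall i, 0 < al k i).
Proof.
move=> k0; split=> [i j Eij|i].
  by rewrite /p /pw Eij divr_gt0 ?weight_total_gt0 ?w_gt0.
by rewrite /al /alphaw divr_gt0 ?weight_total_gt0 ?wa_gt0.
Qed.

Lemma weights_ge0 k : (0 < k)%N -> weights_ge E p al 0 k.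
Proof. by move=> /weights_gt0 [h1 h2]; split=> *; apply: ltW; auto. Qed.

Lemma weights_large k : (0 < k)%N -> large_draws k -> weights_ge E p al c k.
Proof.
move=> k0 [hw hwa].
have tN i : weight_total E w wa k i <= N.+1%:R.
  rewrite /weight_total -natr1 lerD //; last by case/andP: (hwa i).
  apply: (@le_trans _ _ (\sum_(j | out_or_self E i j) 1)).
    by apply: ler_sum => j /hw /andP[].
  rewrite sumr_const ler_nat -[X in (_ <= X)%N]card_ord; exact: max_card.
have ge y i : 2^-1 <= y -> c <= y / weight_total E w wa k i.
  move=> y2; rewrite /c invfM; apply: ler_pM; rewrite ?invr_ge0 //.
  by rewrite lef_pV2 ?posrE ?weight_total_gt0.
split=> [i j Eij|i]; last by apply: ge; case/andP: (hwa i).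
by rewrite /p /pw Eij; apply: ge; case/andP: (hw _ _ Eij).
Qed.

Lemma pps_run_flow l : is_flow E p al (pps_run E x0 a w wa l).
Proof. by case: l => k. Qed.

(** In channel 2 the alpha substates start at 0 and all equal 2 at time 1, when the beta substates
    are still 0; both kinds are positive only from time 2 on. *)
Lemma pps_run_gt0 k i : (1 < k)%N ->
  0 < (pps_run E x0 a w wa false k).1 i /\ 0 < (pps_run E x0 a w wa false k).2 i.
Proof.
have z1 : (pps_run E x0 a w wa false 1).1 = fun=> 2.
  by apply/funext => j; rewrite /= big1 ?add0r // => *; rewrite mulr0.
have nn : nneg (pps_run E x0 a w wa false 1).
  by move=> j; rewrite z1 /= mulr0.
have nnk := flow_nneg (pps_run_flow false) weights_ge0 nn.
have gt1 n j : 0 < (pps_run E x0 a w wa false n.+1).1 j.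
  elim: n j => [|n IH] j; first by rewrite z1.
  rewrite pps_run_flow /= (bigD1 j) ?eqxx ?orbT //= -addrA ltr_pwDl //.
    by apply: mulr_gt0 (IH j); apply: (weights_gt0 _).1 => //;
      rewrite /out_or_self eqxx orbT.
  rewrite addr_ge0 //; last by have [] := nnk n.+1 isT j.
  apply: sumr_ge0 => l /andP[Ejl _]; rewrite mulr_ge0 ?(ltW (IH _)) //.
  by apply/ltW/(weights_gt0 _).1 => //; rewrite /out_or_self eq_sym.
case: k => [//|[//|k]] _; split; first exact: gt1.
by rewrite pps_run_flow mulr_gt0 ?gt1 //; have [_] := @weights_gt0 k.+1 isT.
Qed.

Lemma pps_run_cvg i :
  let run := pps_run E x0 a w wa in
  let avg := N%:R^-1 * \sum_(j < N) x0 j in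
  ((fun k => (run true k).1 i / (run false k).1 i) @ \oo --> avg) /\
  ((fun k => (run true k).2 i / (run false k).2 i) @ \oo --> avg).
Proof.
move=> run avg.
(* The ratio argument starts at time 2, but mass is conserved from time 0, where the terms [a]
   cancel and the masses are explicit. *)
have massE l : mass (run l 2) = mass (run l 0).
  by apply: (flow_mass (k0 := 0) (pps_run_flow l)) => // k _; exact: weights_stochastic.
have N0 : N%:R != 0 :> R by rewrite pnatr_eq0 -lt0n; case: (N) i => // -[].
have c1 : 0 < c by rewrite invr_gt0 mulr_gt0.
have -> : avg = mass (run true 2) / mass (run false 2).
  rewrite !massE /mass /= (eq_bigr (fun j => 2 * x0 j)); last by move=> j _; ring.
  rewrite -mulr_sumr [X in _ / X](_ : _ = 2 * N%:R); first by rewrite /avg; field.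
  by rewrite sumr_const card_ord add0r mulr_natr.
apply: (@flow_ratio_cvg R N E p al 2 (run true) (run false) c) => //.
- rewrite (ltW c1) invf_le1 ?mulr_gt0 // -natrM ler1n muln_gt0 //.
- by move=> k _; exact: weights_stochastic.
- by move=> k k2; apply: weights_ge0; lia.
- by move=> k k2 j; exact: pps_run_gt0.
- move=> k; have [k' kk' hk'] := large k.+1.
  exists k'; first by lia.
  by move=> l lk; apply: weights_large; [lia|exact: hk'].
Qed.
End Run.

(** * Grouping the raw weight draws into time blocks *)

Section DrawBlocks.
Context (N : nat) (E : rel 'I_N).

Definition draw_time (t : draw_idx N) : nat :=
  match t with inl (inl _) => 0 | inl (inr (k, _, _)) => k | inr (k, _) => k end.

Definition draws_at (k : nat) : seq (draw_idx N) :=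
  [seq inl (inr (k, ji.1, ji.2)) |
    ji <- enum [pred ji : 'I_N * 'I_N | out_or_self E ji.2 ji.1]] ++
  [seq inr (k, i) | i <- enum 'I_N].

(** Block [n] covers times n L + 1 to n L + L: the shift by one leaves out the Gaussian draws of
    time 0, and the quotient of time minus one by [L] recovers [n]. *)
Definition draw_block (L n : nat) : seq (draw_idx N) :=
  flatten [seq draws_at k | k <- iota (n * L).+1 L].

Lemma mem_draws_at k t : t \in draws_at k -> draw_time t = k /\ drawn E t.
Proof.
rewrite mem_cat => /orP[] /mapP [].
  by move=> [j i]; rewrite mem_enum => /= Eij ->.
by move=> i _ ->.
Qed.

Lemma uniq_draws_at k : uniq (draws_at k).
Proof.
rewrite cat_uniq; apply/and3P; split.
- by rewrite map_inj_uniq ?enum_uniq // => -[i j] [i' j'] /= [-> ->].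
- by apply/hasPn => t /mapP [i _ ->]; apply/negP => /mapP [].
- by rewrite map_inj_uniq ?enum_uniq // => i j [].
Qed.

Lemma mem_draw_block L n t : t \in draw_block L n ->
  [/\ drawn E t, (0 < draw_time t)%N & ((draw_time t).-1 %/ L)%N = n].
Proof.
move=> /flatten_mapP [k]; rewrite mem_iota => kL /mem_draws_at [-> dt].
split=> //; first by lia.
have L0 : (0 < L)%N by lia.
rewrite (_ : k.-1 = n * L + (k.-1 - n * L))%N; last by lia.
by rewrite divnMDl // divn_small ?addn0 //; lia.
Qed.

Lemma uniq_draw_block L n : uniq (draw_block L n).
Proof.
apply: (uniq_flatten_map (tag := draw_time)) => [k _|k t _|].
- exact: uniq_draws_at.
- by move=> /mem_draws_at [].
- exact: iota_uniq.
Qed.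

Lemma size_draw_block L n : size (draw_block L n) = (L * size (draws_at 0))%N.
Proof.
have sz k : size (draws_at k) = size (draws_at 0) by rewrite !size_cat !size_map.
rewrite /draw_block; elim: L (n * L)%N => //= L IH m.
by rewrite size_cat IH sz mulSn.
Qed.

End DrawBlocks.

Theorem theorem1 (R : realType) (d : measure_display) (T : measurableType d)
  (P : probability T R) (N : nat) (E : rel 'I_N) (M : R)
  (x0 : 'I_N -> R)
  (a : 'I_N -> T -> R) (w : nat -> 'I_N -> 'I_N -> T -> R)
  (wa : nat -> 'I_N -> T -> R) :
  (2 < N)%N ->
  no_self_loops E ->
  strongly_connected E ->
  0 < M ->
  forall hM : - M < M,
  (forall i, has_law P (a i) (uniform_prob hM)) ->
  (forall i j, out_or_self E i j ->
     has_law P (w 0%N j i) (normal_prob 0 (Num.sqrt M))) ->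
  (forall i, has_law P (wa 0%N i) (normal_prob 0 (Num.sqrt M))) ->
  (forall k i j, (0 < k)%N -> out_or_self E i j ->
     has_law P (w k j i) (uniform_prob (@ltr01 R))) ->
  (forall k i, (0 < k)%N -> has_law P (wa k i) (uniform_prob (@ltr01 R))) ->
  mutually_independent P (draw_family a w wa) (drawn E) ->
  forall i : 'I_N,
    \forall om \ae P,
      let run := fun l k =>
        pps_run E x0 (fun j => a j om) (fun k j i => w k j i om)
                (fun k j => wa k j om) l k in
      let avg := N%:R^-1 * \sum_(j < N) x0 j in
      ((fun k => (run true k).1 i / (run false k).1 i) @ \oo --> avg) /\
      ((fun k => (run true k).2 i / (run false k).2 i) @ \oo --> avg).
Proof.
move=> N2 _ Esc M0 hM _ law_w0 law_wa0 law_w law_wa ind i.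
set X := draw_family a w wa.
have law t : drawn E t -> (0 < draw_time t)%N -> has_law P (X t) (uniform_prob (@ltr01 R)).
  case: t => [[//|[[k j] l]]|[k l]] /= dt k0; [exact: law_w|exact: law_wa].
pose S t := drawn E t /\ if t is inl (inl _) then False else True.
have sM0 : Num.sqrt M != 0 by rewrite gt_eqF // sqrtr_gt0.
have indS : mutually_independent P X S.
  by move=> F B uF FS; apply: ind => // t /FS [].
have mX t : S t -> measurable_fun setT (X t).
  case=> dt; case: t dt => [[//|[[[|k] j] l]]|[[|k] l]] /= dt _.
  - by have [] := law_w0 _ _ dt.
  - by have [] := law_w k.+1 _ _ isT dt.
  - by have [] := law_wa0 l.
  - by have [] := law_wa k.+1 l isT.
have total : \forall om \ae P, forall j,
    weight_total E (fun k j i => w k j i om) (fun k j => wa k j om) 0 j != 0.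
  apply: ae_forall_count => j.
  pose F : seq (draw_idx N) :=
    [seq inl (inr (0%N, l, j)) | l <- enum [pred l | out_or_self E j l]].
  (* The Gaussian draw for alpha serves as the summand with bounded density, its bound being the
     peak of the density. *)
  have := @prob_sum_eq0 _ _ _ P _ X S indS mX (normal_peak (Num.sqrt M)) (inr (0%N, j)) F.
  move=> /(_ (normal_peak_ge0 _)) /(_ (conj I I)).
  have dens b b' : b <= b' ->
      (P (X (inr (0%N, j)) @^-1` `[b, b']) <= (normal_peak (Num.sqrt M) * (b' - b))%:E)%E.
    move=> bb'; have [_ ->] := law_wa0 j; last exact: measurable_itv.
    exact: normal_prob_itv_le.
  have uF : uniq (inr (0%N, j) :: F).
    rewrite /= map_inj_uniq ?enum_uniq ?andbT; last by move=> l l' [].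
    by apply/negP => /mapP [].
  have FS t : t \in F -> S t by move=> /mapP [l]; rewrite mem_enum => /= Ejl ->.
  move=> /(_ dens uF FS); apply: filterS => om.
  by rewrite /F big_map big_enum /= addrC.
(* The uniform law gives no mass to the nonpositive reals, and there are only countably many
   draws. *)
have pos : \forall om \ae P, forall t : draw_idx N,
    drawn E t -> (0 < draw_time t)%N -> 0 < X t om.
  apply: ae_forall_count => t.
  have [[dt kt]|nt] := pselect (drawn E t /\ (0 < draw_time t)%N); last first.
    by apply: aeW => om dt kt; case: nt.
  have [mXt lawt] := law t dt kt.
  exists (X t @^-1` `]-oo, 0]); split.
  - by rewrite -[Y in measurable Y]setTI; apply: mXt => //; exact: measurable_itv.
  - by rewrite lawt ?uniform01_le0 //; exact: measurable_itv.
  - move=> om /= hom; rewrite in_itv /= leNgt; apply/negP => Xt; exact: hom.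
pose C : set R := `[2^-1, 1]%classic.
have mC : measurable C by exact: measurable_itv.
pose G n := \big[setI/setT]_(t <- draw_block E N.+2 n) (X t @^-1` C).
have blk n t : t \in draw_block E N.+2 n -> [/\ drawn E t,
    ((draw_time t).-1 %/ N.+2)%N = n & P (X t @^-1` C) = (2^-1)%:E].
  move=> /mem_draw_block [dt t0 tn]; split=> //.
  by have [_ ->] := law t dt t0; rewrite ?uniform01_half.
have mG n : measurable (G n).
  apply: measurable_bigsetI => t /mem_draw_block [dt t0 _].
  by rewrite -[Y in measurable Y]setTI; apply: (law t dt t0).1.
have indG := prob_blocks ind mC (uniq_draw_block E N.+2) (size_draw_block E N.+2) blk.
have io := prob_infinitely_often mG indG.
(* Each block holds the same number of draws, each in [1/2, 1] with probability 1/2, so this is the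
   common probability of the events [G n]. *)
have q0 : 0 < (2^-1 : R) ^+ (N.+2 * size (draws_at E 0)).
  by rewrite exprn_gt0 // invr_gt0.
apply: filterS3 total pos (io q0) => om tot_om pos_om io_om.
apply: (@pps_run_cvg R N E x0 (fun j => a j om) (fun k j l => w k j l om)
  (fun k j => wa k j om)) => //.
- by move=> k j l k0 Ejl; exact: (pos_om (inl (inr (k, l, j))) Ejl k0).
- by move=> k j k0; exact: (pos_om (inr (k, j)) Logic.I k0).
- move=> k; have [n kn] := io_om k; rewrite /G -bigcap_seq => Gn.
  (* The first time of block [n], which exceeds [k] because n >= k. *)
  exists (n * N.+2).+1 => [|l ln]; first by lia.
  have inblk t : t \in draws_at E l -> 2^-1 <= X t om <= 1.
    move=> tl; have : C (X t om); last by rewrite /C /= in_itv.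
    apply: Gn => /=; apply/flatten_mapP; exists l => //; rewrite mem_iota; lia.
  split=> [j j' Ejj'|j].
    apply: (inblk (inl (inr (l, j', j)))); rewrite mem_cat; apply/orP; left.
    by apply/mapP; exists (j', j) => //; rewrite mem_enum.
  apply: (inblk (inr (l, j))); rewrite mem_cat; apply/orP; right.
  by apply/mapP; exists j => //; rewrite mem_enum.
Qed.
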